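(* Let $0<\alpha<1$, $T>0$, $\hbar>0$, and for $x\in(0,1]$ and $u\in\mathbb{R}$ let $$\overline f(u,x)=\frac{\sin(\alpha\pi)}{\alpha\pi}\,\frac{x e^{u-T}}{e^{\frac{1}{\alpha}(u-T)}+x}.$$ Then the sum of the discrete Fourier transforms decays at an exponential rate: $$\sum_{n\ne0}\mathfrak{F}[\overline f]\Big(\frac{2n\pi}{\hbar}\Big)=\frac{\mathcal{O}(1)}{e^{\frac{2\pi^2\alpha}{\hbar}}-1},$$ where the constant in the $\mathcal{O}$ term is independent of $n$, $\hbar$, $x$, $\alpha$ and $\sigma$.
   Context: $\mathfrak{F}[w](\xi)=\int_{-\infty}^{+\infty}w(u)e^{-i\xi u}\,\mathrm{d}u$ denotes the Fourier transform in the variable $u$ (here applied to $u\mapsto\overline f(u,x)$ for fixed $x$). In the paper's setting $\sigma>0$ is a clustering parameter with $T=\sigma\alpha\sqrt{N_1}$ and $\hbar=\sigma\alpha/\sqrt{N_1}$ for a positive integer $N_1$. *)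

(* Defs.v *)
From HB Require Import structures.
From mathcomp Require Import all_boot all_order all_algebra.
From mathcomp Require Import all_classical all_reals all_analysis.
Set Implicit Arguments. Unset Strict Implicit. Unset Printing Implicit Defensive.
Import Order.TTheory GRing.Theory Num.Theory.
Import numFieldNormedType.Exports.
Local Open Scope classical_set_scope.
Local Open Scope ring_scope.

Definition fbar (R : realType) (alpha T x u : R) : R :=
  sin (alpha * pi) / (alpha * pi) *
  (x * expR (u - T) / (expR ((u - T) / alpha) + x)).

(* Fourier transform F[w](xi) = \int w(u) e^{-i xi u} du, split into its
   real part \int w(u) cos(xi u) du and imaginary part -\int w(u) sin(xi u) du
   (Lebesgue integrals over the whole real line). *)
Definition FT_re (R : realType) (w : R -> R) (xi : R) : R :=
  Rintegral (@lebesgue_measure R) setT (fun u => w u * cos (xi * u)).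
Definition FT_im (R : realType) (w : R -> R) (xi : R) : R :=
  - Rintegral (@lebesgue_measure R) setT (fun u => w u * sin (xi * u)).

(* Main.v *)
Require Import Defs.
From HB Require Import structures.
From mathcomp Require Import all_boot all_order all_algebra.
From mathcomp Require Import all_classical all_reals all_analysis.
From mathcomp Require Import measurable_realfun ring lra.
Import Order.TTheory GRing.Theory Num.Theory.
Import numFieldNormedType.Exports.
Local Open Scope classical_set_scope.
Local Open Scope ring_scope.

(** With [m = T + alpha * ln x], [fbar] is a constant times
    [kern u = e^(u - m) / (1 + e^((u - m) / alpha))].  The
    function [e^((1 - i xi) z) / (1 + e^((z - m) / alpha))] is holomorphic in the strip
    [|Im z| < alpha * pi], so its integral over horizontal lines is constant.
    Comparing the lines at heights [+ alpha * th] and [- alpha * th], the factors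
    [e^(+- alpha * xi * th)] separate while the two integrands differ by at most twice the
    Poisson kernel of the strip, whose integral is [sin (alpha * th) * \int kern].
    Letting [th] tend to [pi] bounds the Fourier transform by
    [6 * e^(- alpha * pi * xi)]; the factor [sin (alpha * pi)] compensates the
    blow-up of [\int kern] as [alpha] tends to [1].  A geometric series concludes. *)

(** * Integrals over the real line and the shift of the line of integration *)

Lemma continuous_dominated_integrable (R : realType) (f k : R -> R) :
  continuous f -> (@lebesgue_measure R).-integrable setT (EFin \o k) ->
  (forall x, `|f x| <= k x) ->
  (@lebesgue_measure R).-integrable setT (EFin \o f).
Proof.
move=> cf ik fk; apply: (le_integrable _ _ _ ik) => //.
- by apply/measurable_EFinP; exact: continuous_measurable_fun.
- by move=> x _ /=; rewrite lee_fin (le_trans (fk x)) // ler_norm.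
Qed.

(** The fundamental theorem of calculus on growing symmetric intervals leaves only boundary values
    of [h], which tend to 0; dominated convergence with majorant [k] carries the truncated integrals
    to the full one. *)
Lemma Rintegral_derive_vanishing (R : realType) (h dh k : R -> R) :
  continuous dh -> (forall x : R, is_derive x 1 h (dh x)) ->
  (@lebesgue_measure R).-integrable setT (EFin \o k) ->
  (forall x, `|dh x| <= k x) ->
  h n%:R @[n --> \oo] --> 0 -> h (- n%:R) @[n --> \oo] --> 0 ->
  Rintegral (@lebesgue_measure R) setT dh = 0.
Proof.
move=> cdh dhh ik dhk hp hm.
have mdh : measurable_fun setT dh by exact: continuous_measurable_fun.
(* The shift to [n.+1] keeps the interval nondegenerate, as the fundamental theorem requires,
   already for [n = 0]. *)
pose I n : set R := `[- n.+1%:R, n.+1%:R]%classic.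
have mI n : measurable (I n) by exact: measurable_itv.
have Icv : (\int[lebesgue_measure]_x ((dh \_ (I n)) x)%:E)%E @[n --> \oo] -->
    (\int[lebesgue_measure]_x (dh x)%:E)%E.
  apply: (@dominated_cvg _ _ _ lebesgue_measure setT measurableT
    (fun n x => ((dh \_ (I n)) x)%:E) (EFin \o dh) (EFin \o k)) => //.
  - move=> n; apply/measurable_EFinP/measurable_restrict => //; first exact: mI.
    by rewrite setTI; exact: (measurable_funS measurableT _ mdh).
  - move=> x _; apply: cvg_EFin; first exact: nearW.
    apply: cvg_near_cst; near=> n.
    rewrite /= patchE mem_set//= /I/= in_itv/= -ler_norml.
    near: n; have [N _ HN] := nbhs_infty_ger `|x|.
    exists N => // n /= /HN /le_trans; apply; by rewrite ler_nat.
  - move=> n x _ /=; rewrite lee_fin patchE; case: ifP => // _.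
    by rewrite normr0 (le_trans _ (dhk x)).
have E n : (\int[lebesgue_measure]_x ((dh \_ (I n)) x)%:E)%E =
    (h n.+1%:R - h (- n.+1%:R))%:E.
  transitivity (\int[lebesgue_measure]_(x in I n) (dh x)%:E)%E.
    by rewrite [RHS]integral_mkcond; apply: eq_integral => x _; rewrite !patchE; case: ifP.
  rewrite (@continuous_FTC2 _ dh h) //.
  - by rewrite (@lt_trans _ _ 0) // oppr_lt0.
  - exact: continuous_subspaceT.
  - split; first by move=> x _; have [] := dhh x.
    + apply: cvg_at_right_filter.
      by apply/differentiable_continuous/derivable1_diffP; have [] := dhh (- n.+1%:R).
    + apply: cvg_at_left_filter.
      by apply/differentiable_continuous/derivable1_diffP; have [] := dhh (n.+1%:R).
  - by move=> x _; rewrite derive1E; have [] := dhh x.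
have Z : (h n.+1%:R - h (- n.+1%:R))%:E @[n --> \oo] --> 0%:E.
  apply: cvg_EFin; first exact: nearW.
  rewrite -[X in _ --> X](subr0 (0:R)); apply: cvgB.
  - by rewrite (cvg_shiftS (fun n => h n%:R)).
  - by rewrite (cvg_shiftS (fun n => h (- n%:R))).
rewrite /Rintegral.
suff -> : (\int[lebesgue_measure]_x (dh x)%:E)%E = 0%:E by [].
move: Icv; under eq_fun do rewrite E.
by move=> /cvg_unique; apply.
Unshelve. all: by end_near. Qed.

Lemma derive0_itv_cst (R : realType) (f : R -> R) (a b x y : R) :
  (forall z : R, a < z < b -> is_derive z 1 f 0) ->
  a < x < b -> a < y < b -> f x = f y.
Proof.
move=> df; wlog xy : x y / x <= y => [H xab yab|].
  by case/orP: (le_total x y) => ?; [|symmetry]; exact: H.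
move=> /andP[ax xb] /andP[ay yb].
have sub z : z \in `[x, y] -> a < z < b.
  by rewrite in_itv /= => /andP[xz zy]; rewrite (lt_le_trans ax xz) (le_lt_trans zy yb).
have [z _] : exists2 z, z \in `[x, y] & f y - f x = 0 * (y - x).
  apply: (@MVT_segment _ f (fun=> 0)) => //.
  - by move=> z zxy; apply: df; apply: sub; exact: subset_itv_oo_cc.
  - by apply: derivable_within_continuous => z /sub /df [].
by rewrite mul0r => /eqP; rewrite subr_eq0 => /eqP.
Qed.

(* The hypotheses on [dG] are the Cauchy-Riemann equations for [G - i H] as a
   function of [u + i t / c], so moving the line of integration changes nothing. *)
Lemma Rintegral_line_shift (R : realType) (G H dG : R -> R -> R) (k : R -> R)
    (c r : R) :
  (@lebesgue_measure R).-integrable setT (EFin \o k) ->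
  k n%:R @[n --> \oo] --> 0 -> k (- n%:R) @[n --> \oo] --> 0 ->
  (forall t u : R, `|t| < r -> is_derive t 1 (G ^~ u) (dG t u)) ->
  (forall t u : R, `|t| < r -> is_derive u 1 (H t) (c * dG t u)) ->
  c != 0 ->
  (forall t, `|t| < r -> continuous (G t)) ->
  (forall t, `|t| < r -> continuous (dG t)) ->
  (forall s, s < r -> exists K, forall t u, `|t| <= s ->
     [/\ `|G t u| <= K * k u, `|dG t u| <= K * k u & `|H t u| <= K * k u]) ->
  forall t, `|t| < r ->
    Rintegral (@lebesgue_measure R) setT (G t) =
    Rintegral (@lebesgue_measure R) setT (G 0).
Proof.
move=> ik kp km dGt dHu c0 cG cdG bnd t tr.
(* The bounds are uniform only on [|t| <= s] with [s < r], so the argument runs in a smaller strip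
   that still contains [t]. *)
have [s ts sr] : exists2 s, `|t| < s & s < r by exists ((`|t| + r) / 2); lra.
have [K HK] := bnd _ sr.
have ikK K' : (@lebesgue_measure R).-integrable setT (EFin \o (fun u => K' * k u)).
  rewrite /comp; under eq_fun do rewrite EFinM.
  exact: integrableZl.
have k0 u : 0 <= K * k u.
  by have [+ _ _] := HK t u (ltW ts); exact: le_trans.
apply: (@derive0_itv_cst _ (fun t => Rintegral lebesgue_measure setT (G t)) (- s) s);
  last 2 first.
- by rewrite -ltr_norml.
- by rewrite -ltr_norml normr0 (le_lt_trans _ ts).
move=> z zs.
have sin y : `]- s, s[%classic y -> `|y| < s by rewrite /= in_itv /= -ltr_norml.
have sinr y : `]- s, s[%classic y -> `|y| < r by move=> /sin /lt_trans; apply.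
have zI : `]- s, s[%classic z by rewrite /= in_itv.
have dE y u : `]- s, s[%classic y -> partial1of2 G y u = dG y u.
  by move=> /sinr ys; rewrite partial1of2E; have [_ ->] := dGt y u ys.
have iG x : `]- s, s[%classic x -> (@lebesgue_measure R).-integrable setT (EFin \o G x).
  move=> xs; apply: (continuous_dominated_integrable _ _ _ _ (ikK K)).
    exact/cG/sinr.
  by move=> u; have [] := HK x u (ltW (sin _ xs)).
have dG1 x u : `]- s, s[%classic x -> setT u -> derivable (G ^~ u) x 1.
  by move=> /sinr xs _; have [] := dGt x u xs.
have Gub x u : `]- s, s[%classic x -> setT u -> `|partial1of2 G x u| <= K * k u.
  by move=> xs _; rewrite dE //; have [] := HK x u (ltW (sin _ xs)).
apply: DeriveDef.
  exact: (@derivable_under_integral _ _ _ lebesgue_measure G setT measurableT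
    z (- s) s zI iG dG1 (fun u => K * k u) k0 (ikK K) Gub).
rewrite -derive1E.
rewrite (@differentiation_under_integral _ _ _ lebesgue_measure G setT measurableT
  z (- s) s zI iG dG1 (fun u => K * k u) k0 (ikK K) Gub).
under eq_Rintegral do rewrite dE //.
have idG : (@lebesgue_measure R).-integrable setT (EFin \o dG z).
  apply: (continuous_dominated_integrable _ _ _ _ (ikK K)).
    exact/cdG/sinr.
  by move=> u; have [] := HK z u (ltW (sin _ zI)).
(* Multiplied by [c], the integrand becomes the [u]-derivative of [H z], and [H z] vanishes at both
   ends. *)
apply: (mulfI c0); rewrite mulr0 -RintegralZl //.
have hb (v : nat -> R) : k (v n) @[n --> \oo] --> 0 -> H z (v n) @[n --> \oo] --> 0.
  move=> kv; apply: norm_cvg0.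
  apply: (@squeeze_cvgr _ _ _ _ (fun=> 0) (fun n => K * k (v n))).
  - apply: nearW => n; rewrite normr_ge0 /=.
    by have [] := HK z (v n) (ltW (sin _ zI)).
  - exact: cvg_cst.
  - by rewrite -[X in _ --> X](mulr0 K); apply: cvgMl_tmp.
apply: (@Rintegral_derive_vanishing _ (H z) _ (fun u => (`|c| * K) * k u)).
- by move=> u; apply: cvgMl_tmp; exact/cdG/sinr.
- by move=> u; exact/dHu/sinr.
- exact: ikK.
- move=> u; rewrite normrM -mulrA ler_wpM2l //.
  by have [] := HK z u (ltW (sin _ zI)).
- exact: hb.
- exact: hb.
Qed.

(** * The kernel on the real axis: exponential tails and integral *)

Lemma cvg_expRN_ray (R : realType) (c a : R) : 0 < c ->
  expR (- (c * (x - a))) @[x --> +oo] --> (0 : R).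
Proof.
move=> c0; apply: (@cvg_comp _ _ _ (fun x => c * (x - a)) (fun y => expR (- y))
  _ (pinfty_nbhs R)); last exact: cvgr_expR.
by apply: gt0_cvgMry => //; exact: cvg_addrr.
Qed.

Lemma integral_expRN_ray (R : realType) (c a : R) : 0 < c ->
  (\int[@lebesgue_measure R]_(x in `[a, +oo[) (expR (- (c * (x - a))))%:E
   = c^-1%:E)%E.
Proof.
move=> c0.
have dF (x : R) : is_derive x 1 (fun x => - (c^-1 * expR (- (c * (x - a)))))
    (expR (- (c * (x - a)))).
  apply: is_derive_eq.
  rewrite /GRing.scale /=; have : c != 0 by rewrite gt_eqF.
  by move=> ?; field.
have cf (f : R -> R) (df : R -> R) : (forall x : R, is_derive x 1 f (df x)) -> continuous f.
  move=> H x; apply/differentiable_continuous/derivable1_diffP.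
  by have [] := H x.
rewrite (@ge0_continuous_FTC2y _ _ (fun x => - (c^-1 * expR (- (c * (x - a))))) _ 0) //.
- by rewrite subrr mulr0 oppr0 expR0 mulr1 EFinN oppeK add0e.
- apply: continuous_subspaceT => x.
  apply: continuous_comp; last exact: continuous_expR.
  apply: continuousN; apply: cvgMl_tmp; apply: cvgB; [exact: cvg_id|exact: cvg_cst].
- rewrite -oppr0; apply: cvgN; rewrite -(mulr0 c^-1); apply: cvgMl_tmp.
  exact: cvg_expRN_ray.
- by apply: cvg_at_right_filter; exact: (cf _ _ dF).
- by move=> x _; rewrite derive1E; have [] := dF x.
Qed.

Definition kern {R : realType} (al m u : R) : R :=
  expR (u - m) / (1 + expR ((u - m) / al)).

Lemma kern_ge0 (R : realType) (al m u : R) : 0 <= kern al m u.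
Proof. by rewrite divr_ge0 // ?addr_ge0 // expR_ge0. Qed.

Lemma continuous_expR_affine (R : realType) (a m : R) :
  continuous (fun u : R => expR ((u - m) * a)).
Proof.
move=> u; apply: continuous_comp; last exact: continuous_expR.
by apply: cvgMr_tmp; apply: cvgB; [exact: cvg_id|exact: cvg_cst].
Qed.

Lemma kern_continuous (R : realType) (al m : R) : continuous (kern al m).
Proof.
move=> u; apply: cvgM.
  by have := @continuous_expR_affine R 1 m u; under eq_fun do rewrite mulr1.
apply: cvgV; first by rewrite gt_eqF // addr_gt0 // expR_gt0.
by apply: cvgD; [exact: cvg_cst|exact: continuous_expR_affine].
Qed.

Lemma kern_le_left (R : realType) (al m u : R) : kern al m u <= expR (u - m).
Proof.
rewrite ler_pdivrMr; last by rewrite addr_gt0 // expR_gt0.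
by rewrite ler_peMr ?expR_ge0 // lerDl expR_ge0.
Qed.

(** Dropping the [1] of the denominator leaves an exponential that decays to the right when
    [0 < al < 1]. *)
Lemma kern_le_right (R : realType) (al m u : R) :
  kern al m u <= expR (- ((al^-1 - 1) * (u - m))).
Proof.
rewrite ler_pdivrMr; last by rewrite addr_gt0 // expR_gt0.
rewrite mulrDr mulr1 -expRD.
have -> : - ((al^-1 - 1) * (u - m)) + (u - m) / al = u - m by ring.
by rewrite lerDr expR_ge0.
Qed.

Lemma kern_cvgy (R : realType) (al m : R) : 0 < al -> al < 1 ->
  kern al m n%:R @[n --> \oo] --> (0 : R).
Proof.
move=> al0 al1.
have c0 : 0 < al^-1 - 1 by rewrite subr_gt0 invf_gt1.
apply: (@squeeze_cvgr _ _ _ _ (fun=> 0)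
  (fun n => expR (- ((al^-1 - 1) * (n%:R - m))))).
- by apply: nearW => n; rewrite kern_ge0 kern_le_right.
- exact: cvg_cst.
- apply: (@cvg_comp _ _ _ (fun n => n%:R) (fun x => expR (- ((al^-1 - 1) * (x - m))))
    _ (pinfty_nbhs R)); first exact: cvgr_idn.
  exact: cvg_expRN_ray.
Qed.

Lemma kern_cvgNy (R : realType) (al m : R) :
  kern al m (- n%:R) @[n --> \oo] --> (0 : R).
Proof.
apply: (@squeeze_cvgr _ _ _ _ (fun=> 0) (fun n => expR (- (1 * (n%:R - (- m)))))).
- apply: nearW => n; rewrite kern_ge0 /=.
  by rewrite (le_trans (kern_le_left _ _ _ _)) // ler_expR mul1r opprB addrC.
- exact: cvg_cst.
- apply: (@cvg_comp _ _ _ (fun n => n%:R) (fun x => expR (- (1 * (x - (- m)))))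
    _ (pinfty_nbhs R)); first exact: cvgr_idn.
  exact: cvg_expRN_ray.
Qed.

(** Split at [m]: the left tail bound integrates to [1], the right one to
    [1 / (1/al - 1) = al / (1 - al)], and the sum is [1 / (1 - al)]. *)
Lemma integral_kern_le (R : realType) (al m : R) : 0 < al -> al < 1 ->
  (\int[@lebesgue_measure R]_x (kern al m x)%:E <= ((1 - al)^-1)%:E)%E.
Proof.
move=> al0 al1.
have c0 : 0 < al^-1 - 1 by rewrite subr_gt0 invf_gt1.
have mk (g : R -> R) (D : set R) : measurable D -> continuous g ->
    measurable_fun D (EFin \o g).
  move=> mD cg; apply/measurable_EFinP; apply: (measurable_funS measurableT) => //.
  exact: continuous_measurable_fun.
rewrite -(setUv `]-oo, m]%classic) ge0_integral_setU//=; last 4 first.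
- exact: measurableC.
- by rewrite setUv; apply: mk => //; exact: kern_continuous.
- by move=> x _; rewrite lee_fin kern_ge0.
- exact/disj_setPCl.
have -> : ((1 - al)^-1)%:E = (1%:E + ((al^-1 - 1)^-1)%:E)%E.
  have a0 : al != 0 by rewrite gt_eqF.
  have a1 : 1 - al != 0 by rewrite subr_eq0 gt_eqF.
  by rewrite -EFinD; congr EFin; field; rewrite a0 mulN1r a1.
apply: leeD.
- apply: (@le_trans _ _ (\int[@lebesgue_measure R]_(x in `]-oo, m]) (expR (x - m))%:E)%E).
    apply: ge0_le_integral => //=.
    + by move=> x _; rewrite lee_fin kern_ge0.
    + by apply: mk => //; exact: kern_continuous.
    + apply: mk => //; have := @continuous_expR_affine R 1 m.
      by under eq_fun do rewrite mulr1.
    + by move=> x _; rewrite lee_fin kern_le_left.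
  (* The reflection [x -> - x] turns the left half-line into a ray starting at [- m]; the endpoint
     is first written as [- - m] to match. *)
  rewrite -{1}(opprK m) ge0_integration_by_substitutionNy.
  + have := @integral_expRN_ray R 1 (- m) ltr01; rewrite invr1 => <-.
    rewrite le_eqVlt; apply/predU1P; left; apply: eq_integral => x _ /=.
    by rewrite mul1r opprB addrC.
  + apply: continuous_subspaceT; have := @continuous_expR_affine R 1 m.
    by under eq_fun do rewrite mulr1.
  + by move=> x _; exact: expR_ge0.
- rewrite setCitvl -(@integral_expRN_ray R _ m c0) -integral_itv_obnd_cbnd; last first.
    apply: mk => //.
    have -> : (fun x => expR (- ((al^-1 - 1) * (x - m)))) =
      (fun x => expR ((x - m) * - (al^-1 - 1))).
      by apply/funext => x; congr expR; ring.
    exact: continuous_expR_affine.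
  apply: ge0_le_integral => //=.
  + by move=> x _; rewrite lee_fin kern_ge0.
  + by apply: mk => //; exact: kern_continuous.
  + apply: mk => //.
    have -> : (fun x => expR (- ((al^-1 - 1) * (x - m)))) =
      (fun x => expR ((x - m) * - (al^-1 - 1))).
      by apply/funext => x; congr expR; ring.
    exact: continuous_expR_affine.
  + by move=> x _; rewrite lee_fin kern_le_right.
Qed.

Lemma kern_integrable (R : realType) (al m : R) : 0 < al -> al < 1 ->
  (@lebesgue_measure R).-integrable setT (EFin \o kern al m).
Proof.
move=> al0 al1; apply/integrableP; split.
  by apply/measurable_EFinP; apply: continuous_measurable_fun; exact: kern_continuous.
rewrite (le_lt_trans _ (ltry (1 - al)^-1)) //.
rewrite (le_trans _ (integral_kern_le R al m al0 al1)) //.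
by rewrite le_eqVlt; apply/predU1P; left; apply: eq_integral => x _ /=; rewrite ger0_norm ?kern_ge0.
Qed.

Lemma Rintegral_kern_le (R : realType) (al m : R) : 0 < al -> al < 1 ->
  Rintegral (@lebesgue_measure R) setT (kern al m) <= (1 - al)^-1.
Proof.
move=> al0 al1; rewrite -lee_fin /Rintegral fineK; first exact: integral_kern_le.
exact: (integrable_fin_num _ (kern_integrable R al m al0 al1)).
Qed.

(** * Real and imaginary parts of [1 / (1 + t e^(i th))] *)

(** The squared modulus of [1 + t e^(i th)]. *)
Definition poleD {R : realType} (t th : R) : R := 1 + 2 * t * cos th + t ^+ 2.

(* [pole_re t th - i * pole_im t th = 1 / (1 + t e^(i th))]; [pole_dre] and
   [pole_dim] are the images of [pole_re] and [pole_im] under [t * d/dt]. *)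
Definition pole_re {R : realType} (t th : R) : R := (1 + t * cos th) / poleD t th.
Definition pole_im {R : realType} (t th : R) : R := (t * sin th) / poleD t th.
Definition pole_dre {R : realType} (t th : R) : R :=
  - (t * (cos th + 2 * t + t ^+ 2 * cos th)) / poleD t th ^+ 2.
Definition pole_dim {R : realType} (t th : R) : R :=
  t * sin th * (1 - t ^+ 2) / poleD t th ^+ 2.

(** The two sides differ by [(1 - cos th) / 2 * (1 - t)^2]. Away from [cos th = -1] this bounds the
    denominator below uniformly in [t]. *)
Lemma poleD_ge (R : realType) (t th : R) :
  (1 + cos th) / 2 * (1 + t) ^+ 2 <= poleD t th.
Proof.
rewrite /poleD; have := cos_le1 th; have := sqr_ge0 (1 - t).
move: (cos th) => c t1 c1; have : 0 <= (1 - c) * (1 - t) ^+ 2.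
  by rewrite mulr_ge0 // subr_ge0.
by nra.
Qed.

Lemma cos_gtN1 (R : realType) (th : R) : `|th| < pi -> -1 < cos th.
Proof.
move=> H; rewrite -cos_norm -cospi ltr_cos // ?in_itv /= ?lexx ?pi_ge0 //.
by rewrite normr_ge0 ltW.
Qed.

Lemma poleD_gt0 (R : realType) (t th : R) : 0 < t -> `|th| < pi -> 0 < poleD t th.
Proof.
move=> t0 thpi; apply: lt_le_trans (poleD_ge R t th).
have := cos_gtN1 R th thpi => c1.
by rewrite mulr_gt0 ?exprn_gt0 ?divr_gt0 //; lra.
Qed.

(** Cauchy-Riemann equations in polar form: on a function of [t e^(i th)], the operator [d/dth] acts
    as [i t d/dt], which exchanges the two parts up to sign. *)
Lemma is_derive_pole_angle (R : realType) (t th : R) : 0 < t -> `|th| < pi ->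
  is_derive th 1 (pole_re t) (pole_dim t th) /\
  is_derive th 1 (pole_im t) (- pole_dre t th).
Proof.
move=> t0 thpi; have D0 : poleD t th != 0 by rewrite gt_eqF // poleD_gt0.
have cs : cos th ^+ 2 = 1 - sin th ^+ 2 by exact: cos2sin2.
have dD : is_derive th 1 (poleD t) (- (2 * t * sin th)).
  apply: is_derive_eq; rewrite /GRing.scale /=; ring.
have dV := is_deriveV D0.
(* The denominator is abstracted to a nonzero [D]; [field] uses its value only through this
   equation. *)
have DE : poleD t th = 1 + 2 * t * cos th + t ^+ 2 by [].
move: D0 DE; rewrite /pole_dim /pole_dre /pole_re /pole_im.
split.
- apply: is_derive_eq; move: (poleD t th) D0 DE => D D0 DE.
  rewrite /GRing.scale /=.
  by field: DE cs.
- apply: is_derive_eq; move: (poleD t th) D0 DE => D D0 DE.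
  rewrite /GRing.scale /=.
  by field: DE cs.
Qed.

Lemma is_derive_pole_radius (R : realType) (t th : R) : 0 < t -> `|th| < pi ->
  is_derive t 1 (pole_re ^~ th) (pole_dre t th / t) /\
  is_derive t 1 (pole_im ^~ th) (pole_dim t th / t).
Proof.
move=> t0 thpi; have D0 : poleD t th != 0 by rewrite gt_eqF // poleD_gt0.
have t1 : t != 0 by rewrite gt_eqF.
have dD : is_derive t 1 (poleD ^~ th) (2 * cos th + 2 * t).
  by apply: is_derive_eq; rewrite /GRing.scale /=; ring.
have dV := is_deriveV D0.
have DE : poleD t th = 1 + 2 * t * cos th + t ^+ 2 by [].
move: D0 DE; rewrite /pole_dim /pole_dre /pole_re /pole_im.
split.
- apply: is_derive_eq; move: (poleD t th) D0 DE => D D0 DE.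
  rewrite /GRing.scale /=.
  by field: DE; rewrite D0 t1.
- apply: is_derive_eq; move: (poleD t th) D0 DE => D D0 DE.
  rewrite /GRing.scale /=.
  by field: DE; rewrite D0 t1.
Qed.

(** By [poleD_ge], [1 / poleD] is at most [kap / (1 + t)^2], while the numerators are at most
    [1 + t], respectively [t (1 + t)^2]. The decay [1 / (1 + t)] is the one that [kern] shows for
    [t = e^((u - m) / al)]. *)
Lemma pole_bound (R : realType) (t th kap : R) : 0 < t -> `|th| < pi ->
  2 <= kap * (1 + cos th) ->
  [/\ `|pole_re t th| <= kap / (1 + t), `|pole_im t th| <= kap / (1 + t),
      `|pole_dre t th| <= kap ^+ 2 / (1 + t) &
      `|pole_dim t th| <= kap ^+ 2 / (1 + t)].
Proof.
move=> t0 thpi kc.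
have D0 := poleD_gt0 R t th t0 thpi.
have c1 := cos_gtN1 R th thpi.
have k0 : 0 < kap by nra.
have t1 : 0 < 1 + t by lra.
have DV : (poleD t th)^-1 <= kap / (1 + t) ^+ 2.
  rewrite -[leLHS]mul1r ler_pdivrMr // mulrAC ler_pdivlMr ?exprn_gt0 // mul1r.
  have := ler_wpM2l (ltW k0) (poleD_ge R t th); apply: le_trans.
  have := exprn_gt0 2 t1; move: ((1 + t) ^+ 2) => y y0; nra.
have DV0 : 0 <= (poleD t th)^-1 by rewrite invr_ge0 ltW.
have lc : `|cos th| <= 1 := cos_max th.
have ls : `|sin th| <= 1 := sin_max th.
have B1 x : `|x| <= 1 + t -> `|x / poleD t th| <= kap / (1 + t).
  move=> hx; rewrite normrM (ger0_norm DV0).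
  apply: le_trans (ler_pM (normr_ge0 _) DV0 hx DV) _.
  by rewrite le_eqVlt; apply/predU1P; left; field; rewrite gt_eqF.
have B2 x : `|x| <= t * (1 + t) ^+ 2 -> `|x / poleD t th ^+ 2| <= kap ^+ 2 / (1 + t).
  move=> hx; rewrite normrM -exprVn (ger0_norm (exprn_ge0 2 DV0)).
  have DV2 : (poleD t th)^-1 ^+ 2 <= (kap / (1 + t) ^+ 2) ^+ 2.
    by rewrite ler_sqr ?nnegrE // (le_trans DV0).
  apply: le_trans (ler_pM (normr_ge0 _) (exprn_ge0 2 DV0) hx DV2) _.
  have -> : t * (1 + t) ^+ 2 * (kap / (1 + t) ^+ 2) ^+ 2 =
    kap ^+ 2 / (1 + t) * (t / (1 + t)) by field; rewrite gt_eqF.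
  rewrite ler_piMr ?divr_ge0 ?sqr_ge0 ?(ltW t1) //.
  by rewrite ler_pdivrMr // mul1r lerDr.
have /andP[lc1 lc2] : -1 <= cos th <= 1 by rewrite -ler_norml.
have /andP[ls1 ls2] : -1 <= sin th <= 1 by rewrite -ler_norml.
have t3 : 0 < t ^+ 3 by rewrite exprn_gt0.
(* The numerator estimates are linear in monomials such as [t * cos th] and [t^3 * cos th]; these
   products supply the signs that [lra] needs. *)
have H (y a : R) : 0 <= y -> -1 <= a -> a <= 1 -> 0 <= y * (1 - a) /\ 0 <= y * (1 + a).
  by move=> y0 a1 a2; split; rewrite mulr_ge0 //; lra.
have [c3 c4] := H _ _ (ltW t0) lc1 lc2.
have [c5 c6] := H _ _ (ltW t3) lc1 lc2.
have [s3 s4] := H _ _ (ltW t0) ls1 ls2.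
have [s5 s6] := H _ _ (ltW t3) ls1 ls2.
have t2 := sqr_ge0 t.
by split; [apply: B1|apply: B1|apply: B2|apply: B2]; rewrite ler_norml; apply/andP; split; lra.
Qed.

(** * The holomorphic integrand on the strip *)

(** At [z = u + i al th], [strip_radius] is the modulus of [e^((z - m) / al)], whose argument is
    [th]; [strip_growth] and [strip_phase] are the modulus and argument of
    [e^(- m - i phi) e^((1 - i xi) z)]. *)
Definition strip_radius {R : realType} (al m u : R) : R := expR ((u - m) / al).
Definition strip_growth {R : realType} (al m xi th u : R) : R :=
  expR (u - m + al * xi * th).
Definition strip_phase {R : realType} (al xi phi th u : R) : R := al * th - xi * u - phi.

(* [strip_re - i * strip_im] is the value at [z = u + i al th] of
   [e^(- m - i phi) e^((1 - i xi) z) / (1 + e^((z - m) / al))]. *)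
Definition strip_re {R : realType} (al m xi phi th u : R) : R :=
  strip_growth al m xi th u *
  (cos (strip_phase al xi phi th u) * pole_re (strip_radius al m u) th +
   sin (strip_phase al xi phi th u) * pole_im (strip_radius al m u) th).
Definition strip_im {R : realType} (al m xi phi th u : R) : R :=
  strip_growth al m xi th u *
  (cos (strip_phase al xi phi th u) * pole_im (strip_radius al m u) th -
   sin (strip_phase al xi phi th u) * pole_re (strip_radius al m u) th).
(** Both the [th]-derivative of [strip_re] and [al] times the [u]-derivative of [strip_im]: the one
    Cauchy-Riemann equation that the line shift uses. *)
Definition strip_der {R : realType} (al m xi phi th u : R) : R :=
  al * xi * strip_re al m xi phi th u + al * strip_im al m xi phi th u +
  strip_growth al m xi th u *
  (cos (strip_phase al xi phi th u) * pole_dim (strip_radius al m u) th -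
   sin (strip_phase al xi phi th u) * pole_dre (strip_radius al m u) th).

Lemma strip_radius_gt0 (R : realType) (al m u : R) : 0 < strip_radius al m u.
Proof. exact: expR_gt0. Qed.

Lemma is_derive_strip_angle (R : realType) (al m xi phi th u : R) : `|th| < pi ->
  is_derive th 1 (fun t => strip_re al m xi phi t u) (strip_der al m xi phi th u).
Proof.
move=> thpi.
have [dp dq] := is_derive_pole_angle R _ th (strip_radius_gt0 R al m u) thpi.
have dE : is_derive th 1 (fun t => strip_growth al m xi t u)
    (al * xi * strip_growth al m xi th u).
  by apply: is_derive_eq; rewrite /GRing.scale /= /strip_growth; ring.
have dC : is_derive th 1 (fun t => cos (strip_phase al xi phi t u))
    (- (al * sin (strip_phase al xi phi th u))).
  by apply: is_derive_eq; rewrite /GRing.scale /= /strip_phase; ring.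
have dS : is_derive th 1 (fun t => sin (strip_phase al xi phi t u))
    (al * cos (strip_phase al xi phi th u)).
  by apply: is_derive_eq; rewrite /GRing.scale /= /strip_phase; ring.
apply: is_derive_eq; rewrite /GRing.scale /= /strip_der /strip_re /strip_im; ring.
Qed.

Lemma is_derive_strip_line (R : realType) (al m xi phi th u : R) :
  al != 0 -> `|th| < pi ->
  is_derive u 1 (strip_im al m xi phi th) (al^-1 * strip_der al m xi phi th u).
Proof.
move=> al0 thpi.
have r0 := strip_radius_gt0 R al m u.
have [dp dq] := is_derive_pole_radius R _ th r0 thpi.
have dr : is_derive u 1 (strip_radius al m) (al^-1 * strip_radius al m u).
  by apply: is_derive_eq; rewrite /GRing.scale /= /strip_radius; ring.
(* Chain rule: the radius [r] has derivative [r / al], which cancels the [1 / r] of the radial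
   derivative. *)
have dpr : is_derive u 1 (fun v => pole_re (strip_radius al m v) th)
    (al^-1 * pole_dre (strip_radius al m u) th).
  have -> : al^-1 * pole_dre (strip_radius al m u) th =
      pole_dre (strip_radius al m u) th / strip_radius al m u * (al^-1 * strip_radius al m u).
    by field; rewrite al0 gt_eqF.
  exact (is_derive1_comp dp dr).
have dqr : is_derive u 1 (fun v => pole_im (strip_radius al m v) th)
    (al^-1 * pole_dim (strip_radius al m u) th).
  have -> : al^-1 * pole_dim (strip_radius al m u) th =
      pole_dim (strip_radius al m u) th / strip_radius al m u * (al^-1 * strip_radius al m u).
    by field; rewrite al0 gt_eqF.
  exact (is_derive1_comp dq dr).
have dE : is_derive u 1 (strip_growth al m xi th) (strip_growth al m xi th u).
  by apply: is_derive_eq; rewrite /GRing.scale /= /strip_growth; ring.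
have dC : is_derive u 1 (fun v => cos (strip_phase al xi phi th v))
    (xi * sin (strip_phase al xi phi th u)).
  by apply: is_derive_eq; rewrite /GRing.scale /= /strip_phase; ring.
have dS : is_derive u 1 (fun v => sin (strip_phase al xi phi th v))
    (- (xi * cos (strip_phase al xi phi th u))).
  by apply: is_derive_eq; rewrite /GRing.scale /= /strip_phase; ring.
apply: is_derive_eq; rewrite /GRing.scale /= /strip_der /strip_re /strip_im.
by field.
Qed.

Lemma strip_continuous (R : realType) (al m xi phi th : R) : `|th| < pi ->
  continuous (strip_re al m xi phi th) /\ continuous (strip_der al m xi phi th).
Proof.
move=> thpi.
have idm (v : R) : u - m @[u --> v] --> v - m.
  by apply: cvgB; [exact: cvg_id|exact: cvg_cst].
have cr : continuous (strip_radius al m) := continuous_expR_affine R al^-1 m.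
have cE : continuous (strip_growth al m xi th).
  move=> v; apply: continuous_comp; last exact: continuous_expR.
  by apply: cvgD; [exact: idm|exact: cvg_cst].
have cph : continuous (strip_phase al xi phi th).
  move=> v; apply: cvgB; last exact: cvg_cst.
  apply: cvgB; first exact: cvg_cst.
  by apply: cvgMl_tmp; exact: cvg_id.
have cC : continuous (fun u => cos (strip_phase al xi phi th u)).
  by move=> v; apply: continuous_comp; [exact: cph|exact: continuous_cos].
have cS : continuous (fun u => sin (strip_phase al xi phi th u)).
  by move=> v; apply: continuous_comp; [exact: cph|exact: continuous_sin].
have cr2 : continuous (fun u => strip_radius al m u ^+ 2).
  by move=> v; under eq_fun do rewrite expr2; apply: cvgM; exact: cr.
have cDD : continuous (fun u => poleD (strip_radius al m u) th).
  move=> v; apply: cvgD; last exact: cr2.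
  apply: cvgD; first exact: cvg_cst.
  by apply: cvgMr_tmp; apply: cvgMl_tmp; exact: cr.
have D0 v : poleD (strip_radius al m v) th != 0.
  by rewrite gt_eqF // poleD_gt0 // strip_radius_gt0.
have cV : continuous (fun u => (poleD (strip_radius al m u) th)^-1).
  by move=> v; apply: cvgV; [exact: D0|exact: cDD].
have cV2 : continuous (fun u => (poleD (strip_radius al m u) th ^+ 2)^-1).
  move=> v; apply: cvgV; first by rewrite expf_neq0.
  by under eq_fun do rewrite expr2; apply: cvgM; exact: cDD.
have cp : continuous (fun u => pole_re (strip_radius al m u) th).
  move=> v; apply: cvgM; last exact: cV.
  by apply: cvgD; [exact: cvg_cst|apply: cvgMr_tmp; exact: cr].
have cq : continuous (fun u => pole_im (strip_radius al m u) th).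
  by move=> v; apply: cvgM; [apply: cvgMr_tmp; exact: cr|exact: cV].
have cdp : continuous (fun u => pole_dre (strip_radius al m u) th).
  move=> v; apply: cvgM; last exact: cV2.
  apply: cvgN; apply: cvgM; first exact: cr.
  apply: cvgD; last by apply: cvgMr_tmp; exact: cr2.
  by apply: cvgD; [exact: cvg_cst|apply: cvgMl_tmp; exact: cr].
have cdq : continuous (fun u => pole_dim (strip_radius al m u) th).
  move=> v; apply: cvgM; last exact: cV2.
  apply: cvgM; first by apply: cvgMr_tmp; exact: cr.
  by apply: cvgB; [exact: cvg_cst|exact: cr2].
have cre : continuous (strip_re al m xi phi th).
  move=> v; apply: cvgM; first exact: cE.
  by apply: cvgD; apply: cvgM; [exact: cC|exact: cp|exact: cS|exact: cq].
have cim : continuous (strip_im al m xi phi th).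
  move=> v; apply: cvgM; first exact: cE.
  by apply: cvgB; apply: cvgM; [exact: cC|exact: cq|exact: cS|exact: cp].
split => // v; apply: cvgD.
  by apply: cvgD; apply: cvgMl_tmp; [exact: cre|exact: cim].
apply: cvgM; first exact: cE.
by apply: cvgB; apply: cvgM; [exact: cC|exact: cdq|exact: cS|exact: cdp].
Qed.

(** For [|th| <= s < pi] the denominator stays away from 0, so each piece is a bounded factor times
    [e^(u - m) / (1 + e^((u - m) / al))]. The constant found here blows up as [s] tends to [pi]; it
    serves integrability and the line shift, not the final estimate. *)
Lemma strip_bound (R : realType) (al m xi phi s : R) : 0 < al -> s < pi ->
  exists K, forall th u, `|th| <= s ->
  [/\ `|strip_re al m xi phi th u| <= K * kern al m u,
      `|strip_der al m xi phi th u| <= K * kern al m u &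
      `|strip_im al m xi phi th u| <= K * kern al m u].
Proof.
move=> al0 spi.
have [s0|s0] := ltP s 0.
  exists 0 => th u ths; have := le_lt_trans ths s0.
  by rewrite normr_lt0.
have cs : -1 < cos s by apply: cos_gtN1; rewrite ger0_norm.
(* Chosen for equality in the hypothesis of [pole_bound] at [th = s]; as cosine decreases on
   [[0, pi]], the inequality then holds for all [|th| <= s]. *)
pose kap := 2 / (1 + cos s).
have kap0 : 0 < kap by rewrite divr_gt0 //; lra.
pose e0 := expR (al * `|xi| * s).
pose B := e0 * (2 * kap).
have B0 : 0 <= B by rewrite !mulr_ge0 ?expR_ge0 // ltW.
(* [B] serves [strip_re] and [strip_im]; the coefficients [al |xi|] and [al] and the last summand
   come from the three terms of [strip_der]; the [1] makes the constant at least [B]. *)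
exists (B * (1 + al * `|xi| + al) + e0 * (2 * kap ^+ 2)) => th u ths.
have thpi : `|th| < pi := le_lt_trans ths spi.
have kc : 2 <= kap * (1 + cos th).
  have -> : 2 = kap * (1 + cos s) by rewrite mulfVK // gt_eqF //; lra.
  rewrite ler_pM2l // lerD2l -(cos_norm th).
  rewrite leNgt ltr_cos ?in_itv /= ?s0 ?normr_ge0 ?(ltW spi) ?(ltW thpi) //.
  by rewrite -leNgt.
have r0 := strip_radius_gt0 R al m u.
have [bp bq bdp bdq] := pole_bound R _ th kap r0 thpi kc.
have gE : strip_growth al m xi th u <= e0 * expR (u - m).
  rewrite /strip_growth [leLHS]expRD [leRHS]mulrC ler_pM2l ?expR_gt0 // ler_expR.
  rewrite (le_trans (ler_norm _)) // !normrM (gtr0_norm al0).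
  by rewrite ler_wpM2l // mulr_ge0 // ltW.
have g0 : 0 <= strip_growth al m xi th u by exact: expR_ge0.
have trig (b x y z w : R) : `|x| <= b / (1 + strip_radius al m u) ->
    `|y| <= b / (1 + strip_radius al m u) -> `|z| <= 1 -> `|w| <= 1 ->
    strip_growth al m xi th u * `|z * x + w * y| <= e0 * (2 * b) * kern al m u.
  move=> hx hy hz hw.
  have b0 : 0 <= b / (1 + strip_radius al m u) by exact: le_trans hx.
  apply: (@le_trans _ _ ((e0 * expR (u - m)) * (2 * (b / (1 + strip_radius al m u))))).
    apply: ler_pM => //; apply: (le_trans (ler_normD _ _)).
    rewrite mulr_natl mulr2n !normrM; apply: lerD; rewrite -[leRHS]mul1r; exact: ler_pM.
  by rewrite le_eqVlt; apply/predU1P; left; rewrite /kern /strip_radius; ring.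
have K0 := kern_ge0 R al m u.
have c1 := cos_max (strip_phase al xi phi th u).
have s1 := sin_max (strip_phase al xi phi th u).
have s1N : `|- sin (strip_phase al xi phi th u)| <= 1 by rewrite normrN.
have hre : `|strip_re al m xi phi th u| <= B * kern al m u.
  rewrite normrM (ger0_norm g0); exact: trig.
have him : `|strip_im al m xi phi th u| <= B * kern al m u.
  by rewrite normrM (ger0_norm g0) -mulNr; exact: trig.
have hd : `|strip_growth al m xi th u *
  (cos (strip_phase al xi phi th u) * pole_dim (strip_radius al m u) th -
   sin (strip_phase al xi phi th u) * pole_dre (strip_radius al m u) th)| <=
   e0 * (2 * kap ^+ 2) * kern al m u.
  by rewrite normrM (ger0_norm g0) -mulNr; exact: trig.
have ax0 : 0 <= al * `|xi| by rewrite mulr_ge0 // ltW.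
have ek0 : 0 <= e0 * (2 * kap ^+ 2) by rewrite !mulr_ge0 ?expR_ge0 // ltW.
have BK : B * kern al m u <=
    (B * (1 + al * `|xi| + al) + e0 * (2 * kap ^+ 2)) * kern al m u.
  apply: ler_wpM2r => //; rewrite -[leLHS]addr0; apply: lerD => //.
  by rewrite ler_peMr // -addrA lerDl addr_ge0 // ltW.
split; [exact: le_trans BK| |exact: le_trans BK].
apply: (le_trans (ler_normD _ _)).
rewrite [leRHS]mulrDl; apply: lerD => //.
apply: (le_trans (ler_normD _ _)).
rewrite (normrM (al * xi)) (normrM al xi) (normrM al (strip_im _ _ _ _ _ _)).
rewrite (gtr0_norm al0).
have H1 := ler_wpM2l ax0 hre.
have H2 := ler_wpM2l (ltW al0) him.
apply: (le_trans (lerD H1 H2)).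
rewrite -subr_ge0.
have -> : B * (1 + al * `|xi| + al) * kern al m u -
  (al * `|xi| * (B * kern al m u) + al * (B * kern al m u)) = B * kern al m u by ring.
exact: mulr_ge0.
Qed.

(** The line is moved to height 0, where the imaginary pole part vanishes. The bound [pi] on [|th|]
    is [al * pi] on [|Im z|], the height of the first poles. *)
Lemma Rintegral_strip_re (R : realType) (al m xi phi th : R) :
  0 < al -> al < 1 -> `|th| < pi ->
  Rintegral (@lebesgue_measure R) setT (strip_re al m xi phi th) =
  Rintegral (@lebesgue_measure R) setT (fun u => kern al m u * cos (xi * u + phi)).
Proof.
move=> al0 al1 thpi.
transitivity (Rintegral (@lebesgue_measure R) setT (strip_re al m xi phi 0)).
  have alN : al != 0 by rewrite gt_eqF.
  have cont t : `|t| < pi -> _ := strip_continuous R al m xi phi t.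
  refine (@Rintegral_line_shift _ (strip_re al m xi phi) (strip_im al m xi phi)
    (strip_der al m xi phi) (kern al m) al^-1 pi
    (kern_integrable R al m al0 al1) (kern_cvgy R al m al0 al1) (kern_cvgNy R al m)
    (fun t u => @is_derive_strip_angle R al m xi phi t u)
    (fun t u => @is_derive_strip_line R al m xi phi t u alN) _
    (fun t h => (cont t h).1) (fun t h => (cont t h).2)
    (fun s => @strip_bound R al m xi phi s al0) th thpi).
  by rewrite invr_eq0.
apply: eq_Rintegral => u _.
rewrite /strip_re /strip_growth /strip_phase /pole_re /pole_im /poleD /kern /strip_radius.
rewrite !mulr0 !addr0 sub0r sin0 cos0 mulr0 mul0r mulr0 addr0 mulr1 -opprD cosN.
have := expR_gt0 ((u - m) / al); move: (expR ((u - m) / al)) => t t0.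
have t1 : 1 + t != 0 by rewrite gt_eqF // addr_gt0.
have -> : 1 + 2 * t * 1 + t ^+ 2 = (1 + t) ^+ 2 by ring.
by field.
Qed.

Lemma sin_le_id (R : realType) (x : R) : 0 <= x -> sin x <= x.
Proof.
move=> x0; have [c _] : exists2 c, c \in `[0, x] & sin x - sin 0 = cos c * (x - 0).
  apply: MVT_segment => //.
  by apply: continuous_subspaceT; exact: continuous_sin.
rewrite sin0 !subr0 => ->.
by rewrite -[leRHS]mul1r ler_wpM2r // cos_le1.
Qed.

(** * Comparison of two opposite lines through the Poisson kernel *)

Lemma strip_integrable (R : realType) (al m xi phi th : R) :
  0 < al -> al < 1 -> `|th| < pi ->
  (@lebesgue_measure R).-integrable setT (EFin \o strip_re al m xi phi th).
Proof.
move=> al0 al1 thpi.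
have [K HK] := strip_bound R al m xi phi _ al0 thpi.
apply: (@continuous_dominated_integrable _ _ (fun u => K * kern al m u)).
- by have [] := strip_continuous R al m xi phi th thpi.
- rewrite /comp; under eq_fun do rewrite EFinM.
  by apply: integrableZl => //; exact: kern_integrable.
- by move=> u; have [] := HK th u (lexx _).
Qed.

(* For [xi = 0] and this phase the integrand is the Poisson kernel of the strip;
   it dominates the jump between the lines at heights [th] and [- th]. *)
Definition strip_poisson {R : realType} (al m th : R) : R -> R :=
  strip_re al m 0 (al * th - pi / 2) th.

Lemma strip_poissonE (R : realType) (al m th u : R) :
  strip_poisson al m th u = expR (u - m) * pole_im (strip_radius al m u) th.
Proof.
rewrite /strip_poisson /strip_re /strip_growth mulr0 mul0r addr0.
have -> : strip_phase al 0 (al * th - pi / 2) th u = pi / 2 by rewrite /strip_phase; ring.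
by rewrite cos_pihalf sin_pihalf mul0r mul1r add0r.
Qed.

(** An instance of the line shift, hence an exact value; it stays bounded as [th] tends to [pi],
    unlike the constant of [strip_bound]. *)
Lemma Rintegral_strip_poisson (R : realType) (al m th : R) :
  0 < al -> al < 1 -> `|th| < pi ->
  Rintegral (@lebesgue_measure R) setT (strip_poisson al m th) =
  Rintegral (@lebesgue_measure R) setT (kern al m) * sin (al * th).
Proof.
move=> al0 al1 thpi; rewrite /strip_poisson Rintegral_strip_re //.
rewrite -RintegralZr //; last exact: kern_integrable.
by apply: eq_Rintegral => u _; rewrite mul0r add0r cosBpihalf.
Qed.

(** The prefactors cancel the growth in [xi], and the shift of [phi] by [2 al th] makes the two
    phases equal. Then [pole_re], even in [th], cancels and [pole_im], odd in [th], doubles. *)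
Lemma strip_jump (R : realType) (al m xi phi th u : R) :
  expR (al * xi * th) * strip_re al m xi phi (- th) u -
  expR (- (al * xi * th)) * strip_re al m xi (phi + 2 * (al * th)) th u =
  2 * sin (xi * u + phi + al * th) * strip_poisson al m th u.
Proof.
rewrite strip_poissonE /strip_re /strip_growth.
have -> : strip_phase al xi phi (- th) u = - (xi * u + phi + al * th).
  by rewrite /strip_phase; ring.
have -> : strip_phase al xi (phi + 2 * (al * th)) th u = - (xi * u + phi + al * th).
  by rewrite /strip_phase; ring.
have -> : pole_re (strip_radius al m u) (- th) = pole_re (strip_radius al m u) th.
  by rewrite /pole_re /poleD cosN.
have -> : pole_im (strip_radius al m u) (- th) = - pole_im (strip_radius al m u) th.
  by rewrite /pole_im /poleD cosN sinN mulrN mulNr.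
rewrite mulrN !expRD cosN sinN.
have := expRxMexpNx_1 (al * xi * th).
move: (expR (al * xi * th)) (expR (- (al * xi * th))) => a b ab.
by ring: ab.
Qed.

Lemma norm_Rintegral_kern_cos (R : realType) (al m xi phi : R) :
  0 < al -> al < 1 ->
  `|Rintegral (@lebesgue_measure R) setT (fun u => kern al m u * cos (xi * u + phi))|
  <= Rintegral (@lebesgue_measure R) setT (kern al m).
Proof.
move=> al0 al1.
have ik := kern_integrable R al m al0 al1.
have bk u : `|kern al m u * cos (xi * u + phi)| <= kern al m u.
  rewrite normrM (ger0_norm (kern_ge0 _ _ _ _)) -[leRHS]mulr1.
  by apply: ler_wpM2l; [exact: kern_ge0|exact: cos_max].
have ic : (@lebesgue_measure R).-integrable setT
    (EFin \o (fun u => kern al m u * cos (xi * u + phi))).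
  apply: continuous_dominated_integrable ik bk => u.
  apply: cvgM; first exact: kern_continuous.
  apply: continuous_comp; last exact: continuous_cos.
  by apply: cvgD; [apply: cvgMl_tmp; exact: cvg_id|exact: cvg_cst].
apply: (le_trans (le_normr_Rintegral _ ic)) => //.
apply: le_Rintegral => //.
exact: integrable_abse ic.
Qed.

(** With [X], [Y] the integrals for the phases [phi] and [phi + 2 al th], and [J] that of [kern],
    integrating [strip_jump] bounds [e^(al xi th) X - e^(- al xi th) Y] by [2 J sin (al th)]. The
    term in [Y] costs at most one more [J]. *)
Lemma norm_Rintegral_kern_cos_decay (R : realType) (al m xi phi th : R) :
  0 < al -> al < 1 -> 0 <= xi -> 0 <= th -> th < pi ->
  expR (al * xi * th) *
  `|Rintegral (@lebesgue_measure R) setT (fun u => kern al m u * cos (xi * u + phi))|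
  <= Rintegral (@lebesgue_measure R) setT (kern al m) * (1 + 2 * sin (al * th)).
Proof.
move=> al0 al1 xi0 th0 thpi.
have thpi1 : `|th| < pi by rewrite ger0_norm.
have thpi2 : `|- th| < pi by rewrite normrN.
pose f1 u := expR (al * xi * th) * strip_re al m xi phi (- th) u.
pose f2 u := expR (- (al * xi * th)) * strip_re al m xi (phi + 2 * (al * th)) th u.
have iZ c (f : R -> R) : (@lebesgue_measure R).-integrable setT (EFin \o f) ->
    (@lebesgue_measure R).-integrable setT (EFin \o (fun u => c * f u)).
  by move=> i; rewrite /comp; under eq_fun do rewrite EFinM; exact: integrableZl.
have i1 : (@lebesgue_measure R).-integrable setT (EFin \o f1).
  by apply: iZ; exact: strip_integrable.
have i2 : (@lebesgue_measure R).-integrable setT (EFin \o f2).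
  by apply: iZ; exact: strip_integrable.
have iP : (@lebesgue_measure R).-integrable setT (EFin \o strip_poisson al m th).
  exact: strip_integrable.
have i12 : (@lebesgue_measure R).-integrable setT (EFin \o (fun u => f1 u - f2 u)).
  by rewrite /comp; under eq_fun do rewrite EFinB; exact: integrableB.
have jump : `|Rintegral (@lebesgue_measure R) setT (fun u => f1 u - f2 u)| <=
    2 * (Rintegral (@lebesgue_measure R) setT (kern al m) * sin (al * th)).
  apply: (le_trans (le_normr_Rintegral _ i12)) => //.
  rewrite -Rintegral_strip_poisson // -RintegralZl //.
  apply: le_Rintegral => //; first exact: integrable_abse i12.
    exact: iZ.
  move=> u _; rewrite /f1 /f2 strip_jump.
  (* Since the kernel is nonnegative, bounding the sine by 1 leaves its integral, which is known
     exactly. *)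
  have P0 : 0 <= strip_poisson al m th u.
    rewrite strip_poissonE mulr_ge0 ?expR_ge0 // /pole_im divr_ge0 //.
      by rewrite mulr_ge0 ?(ltW (strip_radius_gt0 _ _ _ _)) // sin_ge0_pi // th0 ltW.
    by rewrite ltW // poleD_gt0 // strip_radius_gt0.
  rewrite normrM (ger0_norm P0) ler_wpM2r // normrM normr_nat.
  by rewrite ler_piMr // sin_max.
have E1 : Rintegral lebesgue_measure setT f1 = _ :=
  RintegralZl (expR (al * xi * th)) measurableT
    (strip_integrable R al m xi phi _ al0 al1 thpi2).
have E2 : Rintegral lebesgue_measure setT f2 = _ :=
  RintegralZl (expR (- (al * xi * th))) measurableT
    (strip_integrable R al m xi (phi + 2 * (al * th)) _ al0 al1 thpi1).
move: jump; rewrite (RintegralB measurableT i1 i2) E1 E2.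
rewrite (Rintegral_strip_re R al m xi phi _ al0 al1 thpi2).
rewrite (Rintegral_strip_re R al m xi (phi + 2 * (al * th)) _ al0 al1 thpi1).
have := norm_Rintegral_kern_cos R al m xi (phi + 2 * (al * th)) al0 al1.
set Y := Rintegral _ _ (fun u => _ * cos (_ + (_ + _))).
set X := Rintegral _ _ (fun u => _ * cos _).
set J := Rintegral _ _ _; move=> hY hJ.
have e1 : expR (- (al * xi * th)) <= 1.
  by rewrite expR_le1 oppr_le0 !mulr_ge0 // ltW.
rewrite -[X in X * `|_| <= _](ger0_norm (expR_ge0 _)) -normrM.
have := ler_normD (expR (al * xi * th) * X - expR (- (al * xi * th)) * Y)
  (expR (- (al * xi * th)) * Y); rewrite subrK => /le_trans; apply.
rewrite mulrDr mulr1 addrC (mulrCA J); apply: lerD => //.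
by rewrite normrM (ger0_norm (expR_ge0 _)) (le_trans _ hY) // ler_piMl.
Qed.

(** The line [th = pi] passes through a pole, so this endpoint is reached only as a left limit; both
    sides are continuous in [th]. *)
Lemma norm_Rintegral_kern_cos_pi (R : realType) (al m xi phi : R) :
  0 < al -> al < 1 -> 0 <= xi ->
  expR (al * xi * pi) *
  `|Rintegral (@lebesgue_measure R) setT (fun u => kern al m u * cos (xi * u + phi))|
  <= Rintegral (@lebesgue_measure R) setT (kern al m) * (1 + 2 * sin (al * pi)).
Proof.
move=> al0 al1 xi0.
set X := `|_|; set J := Rintegral _ _ _.
apply: (@ler_cvg_to _ (pi^'-) _ _ (fun th => expR (al * xi * th) * X)
  (fun th => J * (1 + 2 * sin (al * th)))).
- apply: cvg_at_left_filter; apply: cvgMr_tmp.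
  apply: continuous_comp; last exact: continuous_expR.
  by apply: cvgMl_tmp; exact: cvg_id.
- apply: cvg_at_left_filter; apply: cvgMl_tmp; apply: cvgD; first exact: cvg_cst.
  apply: cvgMl_tmp; apply: continuous_comp; last exact: continuous_sin.
  by apply: cvgMl_tmp; exact: cvg_id.
- near=> th; apply: norm_Rintegral_kern_cos_decay => //.
  by apply: ltW; near: th; apply: nbhs_left_gt; exact: pi_gt0.
Unshelve. all: by end_near. Qed.

(** * Uniform constants and the transform of [fbar] *)

(** The zero of [sin (al pi)] at [al = 1] compensates [1 / (1 - al)]: use [sin (al pi) <= al pi] up
    to [al = 1/2], and [sin (al pi) = sin ((1 - al) pi) <= (1 - al) pi] beyond. *)
Lemma sinc_div_le2 (R : realType) (al : R) : 0 < al -> al < 1 ->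
  sin (al * pi) / (al * pi) / (1 - al) <= 2.
Proof.
move=> al0 al1; have p0 := pi_gt0 R.
have ap0 : 0 < al * pi by rewrite mulr_gt0.
have a1 : 0 < 1 - al by rewrite subr_gt0.
rewrite ler_pdivrMr // ler_pdivrMr //.
have s1 : sin (al * pi) <= al * pi by apply: sin_le_id; exact: ltW.
have s2 : sin (al * pi) <= (1 - al) * pi.
  have -> : sin (al * pi) = sin ((1 - al) * pi).
    by rewrite mulrBl mul1r sinB sinpi cospi mul0r sub0r mulN1r opprK.
  by apply: sin_le_id; rewrite mulr_ge0 // ltW.
have [h|h] := leP al (1 / 2).
  apply: (le_trans s1); rewrite ler_peMl ?(ltW ap0) //; lra.
apply: (le_trans s2).
have -> : 2 * (1 - al) * (al * pi) = (2 * al) * ((1 - al) * pi) by ring.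
by rewrite ler_peMl ?mulr_ge0 ?(ltW a1) ?(ltW p0) //; lra.
Qed.

(** Dividing numerator and denominator by [x] turns [x] into a translation by [al * ln x], at the
    price of the factor [x^al], written [expR (al * ln x)]. *)
Lemma fbarE (R : realType) (al T x u : R) : 0 < al -> 0 < x ->
  fbar al T x u = sin (al * pi) / (al * pi) * expR (al * ln x) *
    kern al (T + al * ln x) u.
Proof.
move=> al0 x0; rewrite /fbar /kern -!mulrA; congr (_ * (_ * _)).
have aN : al != 0 by rewrite gt_eqF.
have -> : (u - (T + al * ln x)) / al = (u - T) / al - ln x by field.
have -> : u - T = al * ln x + (u - (T + al * ln x)) by ring.
rewrite [in LHS]expRD.
have -> : (al * ln x + (u - (T + al * ln x))) / al = (u - T) / al by field.
rewrite (expRB _ (ln x)) lnK ?posrE //.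
have := expR_gt0 ((u - T) / al); move: (expR ((u - T) / al)) => t t0.
have xN : x != 0 by rewrite gt_eqF.
have tx : t + x != 0 by rewrite gt_eqF // addr_gt0.
by field; rewrite xN addrC tx.
Qed.

(** The constant is [2 * 3]: [sinc_div_le2] gives [2], and [1 + 2 sin (al pi) <= 3]. The factor
    [x^al] is at most 1 because [x <= 1]. *)
Lemma norm_FT_re_fbar (R : realType) (al T x xi : R) :
  0 < al -> al < 1 -> 0 < x -> x <= 1 -> 0 <= xi ->
  `|FT_re (fbar al T x) xi| <= 6 * expR (- (al * xi * pi)).
Proof.
move=> al0 al1 x0 x1 xi0; have p0 := pi_gt0 R.
rewrite /FT_re; set m := T + al * ln x.
pose c := sin (al * pi) / (al * pi).
have s0 : 0 <= sin (al * pi).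
  by rewrite sin_ge0_pi // mulr_ge0 ?(ltW al0) ?(ltW p0) //= ler_piMl ?ltW.
have c0 : 0 <= c by rewrite divr_ge0 // mulr_ge0 ?ltW.
pose X := Rintegral (@lebesgue_measure R) setT (fun u => kern al m u * cos (xi * u + 0)).
have -> : Rintegral (@lebesgue_measure R) setT (fun u => fbar al T x u * cos (xi * u)) =
    c * expR (al * ln x) * X.
  rewrite -RintegralZl //.
    by apply: eq_Rintegral => u _; rewrite fbarE // mulrA addr0.
  apply: (continuous_dominated_integrable _ _ _ _ (kern_integrable R al m al0 al1)).
    move=> u; apply: cvgM; first exact: kern_continuous.
    apply: continuous_comp; last exact: continuous_cos.
    by apply: cvgD; [apply: cvgMl_tmp; exact: cvg_id|exact: cvg_cst].
  move=> u; rewrite normrM (ger0_norm (kern_ge0 _ _ _ _)) -[leRHS]mulr1.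
  by apply: ler_wpM2l; [exact: kern_ge0|exact: cos_max].
have xa : expR (al * ln x) <= 1.
  by rewrite expR_le1 mulr_ge0_le0 ?(ltW al0) // ln_le0.
have Xb := norm_Rintegral_kern_cos_pi R al m xi 0 al0 al1 xi0.
have Jb := Rintegral_kern_le R al m al0 al1.
have cb : c / (1 - al) <= 2 := sinc_div_le2 R al al0 al1.
rewrite expRN ler_pdivlMr ?expR_gt0 // normrM (normrM c) (ger0_norm c0) (ger0_norm (expR_ge0 _)).
have -> : c * expR (al * ln x) * `|X| * expR (al * xi * pi) =
  c * expR (al * ln x) * (expR (al * xi * pi) * `|X|) by ring.
have s3 : 1 + 2 * sin (al * pi) <= 3 by have := sin_le1 (al * pi); lra.
have XJ : expR (al * xi * pi) * `|X| <= (1 - al)^-1 * 3.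
  apply: (le_trans Xb); apply: ler_pM => //.
    by apply: Rintegral_ge0 => u _; exact: kern_ge0.
  by rewrite addr_ge0 // mulr_ge0.
apply: (@le_trans _ _ (c * ((1 - al)^-1 * 3))).
  apply: ler_pM => //; first by rewrite mulr_ge0 // expR_ge0.
  by rewrite ler_piMr.
have -> : 6 = 2 * 3 :> R by ring.
by rewrite mulrA ler_wpM2r.
Qed.

(** * Summation over the frequencies *)

Lemma series_geometric_bound (R : realType) (a : nat -> R) (c z : R) :
  0 <= c -> 0 <= z -> z < 1 -> (forall n, `|a n| <= c * z ^+ n) ->
  exists2 S, series a @ \oo --> S & `|S| <= c / (1 - z).
Proof.
move=> c0 z0 z1 acz.
have cg : series (geometric c z) @ \oo --> c / (1 - z).
  by apply: cvg_geometric_series; rewrite ger0_norm.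
have icg : cvgn (series (geometric c z)) by apply/cvg_ex; exists (c / (1 - z)).
have na : cvgn [normed series a].
  apply: (@series_le_cvg _ (fun n => `|a n|) (geometric c z)) icg => n.
  - exact: normr_ge0.
  - exact: geometric_ge0.
  - exact: acz.
exists (limn (series a)); first exact: normed_cvg na.
apply: (le_trans (lim_series_norm na)); rewrite -(cvg_lim _ cg) //.
exact: lim_series_le.
Qed.

(** The sum over nonzero [n] pairs opposite frequencies, and the square root is the modulus of the
    complex sum. Integrability is asserted because [Rintegral] has a value for nonintegrable
    functions too. *)
Theorem theorem3p2 (R : realType) :
  exists C : R,
  forall alpha T hbar x : R,
    0 < alpha -> alpha < 1 -> 0 < T -> 0 < hbar -> 0 < x -> x <= 1 ->
    (@lebesgue_measure R).-integrable setT (EFin \o fbar alpha T x) /\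
    exists Sre Sim : R,
      series (fun n : nat =>
        FT_re (fbar alpha T x) (2 * n.+1%:R * pi / hbar) +
        FT_re (fbar alpha T x) (- (2 * n.+1%:R * pi / hbar))) @ \oo --> Sre /\
      series (fun n : nat =>
        FT_im (fbar alpha T x) (2 * n.+1%:R * pi / hbar) +
        FT_im (fbar alpha T x) (- (2 * n.+1%:R * pi / hbar))) @ \oo --> Sim /\
      Num.sqrt (Sre ^+ 2 + Sim ^+ 2)
        <= C / (expR (2 * pi ^+ 2 * alpha / hbar) - 1).
Proof.
(* Twice the [6] of [norm_FT_re_fbar], for the two frequencies of a pair. *)
exists 12 => alpha T hbar x al0 al1 T0 h0 x0 x1.
have p0 := pi_gt0 R.
(* The exponent [alpha * xi * pi] at the first frequency [xi = 2 pi / hbar]. *)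
pose b := 2 * pi ^+ 2 * alpha / hbar.
have b0 : 0 < b by rewrite divr_gt0 // !mulr_gt0.
have ifb : (@lebesgue_measure R).-integrable setT (EFin \o fbar alpha T x).
  pose c := sin (alpha * pi) / (alpha * pi) * expR (alpha * ln x).
  have -> : fbar alpha T x = (fun u => c * kern alpha (T + alpha * ln x) u).
    by apply/funext => u; exact: fbarE.
  rewrite /comp; under eq_fun do rewrite EFinM.
  by apply: integrableZl => //; exact: kern_integrable.
have reN xi : FT_re (fbar alpha T x) (- xi) = FT_re (fbar alpha T x) xi.
  by apply: eq_Rintegral => u _; rewrite mulNr cosN.
have imN xi : FT_im (fbar alpha T x) xi + FT_im (fbar alpha T x) (- xi) = 0.
  have isin y : (@lebesgue_measure R).-integrable setT
      (EFin \o (fun u => fbar alpha T x u * sin (y * u))).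
    have mf : measurable_fun setT (fbar alpha T x).
      by apply/measurable_EFinP; have /integrableP[] := ifb.
    apply: (le_integrable _ _ _ ifb) => //.
      apply/measurable_EFinP; apply: measurable_funM => //.
      apply: continuous_measurable_fun => u.
      apply: continuous_comp; last exact: continuous_sin.
      by apply: cvgMl_tmp; exact: cvg_id.
    by move=> u _ /=; rewrite lee_fin normrM ler_piMr // sin_max.
  rewrite /FT_im -opprD -RintegralD //.
  rewrite (_ : (fun u => _) = cst 0) ?Rintegral_cst // ?mul0r ?oppr0 //.
  by apply/funext => u /=; rewrite mulNr sinN mulrN subrr.
split => //.
pose a (n : nat) := FT_re (fbar alpha T x) (2 * n.+1%:R * pi / hbar) +
  FT_re (fbar alpha T x) (- (2 * n.+1%:R * pi / hbar)).
(* Index [n] stands for the frequency number [n.+1], so the geometric series starts with a factor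
   [e^(- b)]. *)
have ab n : `|a n| <= 12 * expR (- b) * expR (- b) ^+ n.
  have -> : a n = 2 * FT_re (fbar alpha T x) (2 * n.+1%:R * pi / hbar).
    by rewrite /a reN; ring.
  rewrite normrM normr_nat.
  have xi0 : 0 <= 2 * n.+1%:R * pi / hbar by rewrite divr_ge0 ?mulr_ge0 ?ltW.
  apply: (le_trans (ler_wpM2l _ (norm_FT_re_fbar R alpha T x _ al0 al1 x0 x1 xi0))) => //.
  rewrite -[leRHS]mulrA -exprS -expRM_natl.
  have -> : n.+1%:R * - b = - (alpha * (2 * n.+1%:R * pi / hbar) * pi).
    by rewrite /b; field; rewrite gt_eqF.
  by rewrite le_eqVlt; apply/predU1P; left; ring.
have e0 : 0 <= 12 * expR (- b) by rewrite mulr_ge0 // expR_ge0.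
have e1 : expR (- b) < 1 by rewrite expR_lt1 oppr_lt0.
have [S cvS bS] := @series_geometric_bound R a _ _ e0 (expR_ge0 _) e1 ab.
exists S, 0; split => //; split.
  under eq_fun do rewrite imN.
  have -> : series (fun=> 0 : R) = cst 0.
    by apply/funext => n; rewrite /series /= big1.
  exact: cvg_cst.
rewrite [0 ^+ 2]expr2 mulr0 addr0 sqrtr_sqr (le_trans bS) // -/b.
(* Here [12 e^(- b) / (1 - e^(- b)) = 12 / (e^b - 1)]. *)
rewrite le_eqVlt; apply/predU1P; left; rewrite expRN.
have e2 : expR b - 1 != 0 by rewrite subr_eq0 gt_eqF // expR_gt1.
by field; rewrite e2 expR_eq0.
Qed.
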